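(* Let $k_1,k_2,n$ be positive integers with $k_1\le k_2$ and $k_1+k_2\ge 4$, and let $p$ be a prime with $p\mid k_1+k_2+1$ and $p\ne k_1+k_2+1$. If there exists a perfect $B[-k_1,k_2](p^n)$ set, then $p^n=k_1+k_2+1$.
   Context: For a positive integer $q$, $\mathbb{Z}_q$ is the ring of integers modulo $q$. For integers $a\le b$, $[a,b]^\ast=\{a,a+1,\dots,b\}\setminus\{0\}$. For non-negative integers $0\le k_1\le k_2$ and a positive integer $q$, a set $B\subseteq\mathbb{Z}_q$ is a $B[-k_1,k_2](q)$ set (splitter set) if, for each $b\in B$, the set $\{ab \bmod q: a\in[-k_1,k_2]^\ast\}$ consists of $k_1+k_2$ distinct nonzero elements, and these sets are pairwise disjoint for distinct $b\in B$. Such a set is perfect if $|B|=(q-1)/(k_1+k_2)$; equivalently, every nonzero element of $\mathbb{Z}_q$ has a unique representation $ab$ with $a\in[-k_1,k_2]^\ast$, $b\in B$ (and $0$ has no such representation). *)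

(* Defs.v *)
From HB Require Import structures.
From mathcomp Require Import all_boot all_order all_algebra.
Set Implicit Arguments. Unset Strict Implicit. Unset Printing Implicit Defensive.
Import Order.TTheory GRing.Theory Num.Theory.
Local Open Scope ring_scope.

Definition intv_star (a b : int) (x : int) : bool := (a <= x) && (x <= b) && (x != 0).

Definition resq (q : nat) (x : int) : int := (x %% (q%:Z))%Z.

Definition splitter (k1 k2 q : nat) (B : {set 'I_q}) : Prop :=
  (forall b, b \in B ->
     (forall a, intv_star (- k1%:Z) k2%:Z a -> resq q (a * (nat_of_ord b)%:Z) != 0) /\
     (forall a a', intv_star (- k1%:Z) k2%:Z a -> intv_star (- k1%:Z) k2%:Z a' ->
        resq q (a * (nat_of_ord b)%:Z) = resq q (a' * (nat_of_ord b)%:Z) -> a = a')) /\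
  (forall b b', b \in B -> b' \in B -> b != b' ->
     forall a a', intv_star (- k1%:Z) k2%:Z a -> intv_star (- k1%:Z) k2%:Z a' ->
        resq q (a * (nat_of_ord b)%:Z) != resq q (a' * (nat_of_ord b')%:Z)).

(* perfect: |B| = (q-1)/(k1+k2), stated multiplicatively (exact division) *)
Definition perfect_splitter (k1 k2 q : nat) (B : {set 'I_q}) : Prop :=
  splitter k1 k2 B /\ (#|B| * (k1 + k2) = q - 1)%N.

(* Main.v *)
Require Import Defs.
From HB Require Import structures.
From mathcomp Require Import all_boot all_order all_algebra.
From mathcomp Require Import all_fingroup all_solvable all_field.
From mathcomp Require Import zify ring.
Set Implicit Arguments. Unset Strict Implicit. Unset Printing Implicit Defensive.
Import Order.TTheory GRing.Theory Num.Theory.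
Local Open Scope ring_scope.

(** Let [M] be the set of nonzero integers in [[-k1, k2]].  The units of [M] times
    the units of [B] factor the unit group [U] of [Z_(p^n)]; counting gives
    [k1 + k2 + 1 = p^r] with [r > 1].  Suppose [r < n].

    For [p] odd, [U] is cyclic of order [p^(n-1) (p-1)], and a character of order
    [p^(n-1)] must vanish on one of the two factors.  As the cyclotomic polynomial
    of order [p^(n-1)] is irreducible, that factor meets each coset of the subgroup
    of order [p (p-1)] in a multiple of [p] elements, so two of its elements agree
    modulo [p^(n-1)] by the pigeonhole principle.  This is impossible: [M] is shorter
    than [p^(n-1)], and [p] belongs to [M], so elements of [B] differ modulo [p^(n-1)].

    For [p = 2], the odd multipliers [a] with [2^j a] in [M], where [j = r - 2] or
    [j = r - 3], form [{1, 3}], [{1, -1, 3, -3}] or [{1, -1, 3, 5}], and their products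
    with the odd part [B0] of [B] cover each odd class modulo [2^(n-j)] once.  It
    follows that [9 B0 = B0], [9 (B0 u -B0) = B0 u -B0] or [9 B0 = 25 B0] respectively,
    so [B0], or [B0 u -B0], is stable under [1 + 2^(n-j-1)], which [2^(j+1)] in [M]
    forbids. *)

(** * Cyclotomic polynomials and vanishing sums of roots of unity *)

Lemma Cyclotomic_prime_power p m : prime p ->
  'Phi_(p ^ m.+1) * ('X^(p ^ m) - 1) = 'X^(p ^ m.+1) - 1.
Proof.
move=> p_pr; have pgt0 := prime_gt0 p_pr.
rewrite -!prod_Cyclotomic ?expn_gt0 ?pgt0 //.
have perm: perm_eq (divisors (p ^ m.+1)) (p ^ m.+1 :: divisors (p ^ m))%N.
  apply: uniq_perm => [||d]; first exact: divisors_uniq.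
    rewrite /= divisors_uniq andbT -dvdn_divisors ?expn_gt0 ?pgt0 //.
    by rewrite dvdn_Pexp2l ?prime_gt1 // ltnn.
  rewrite inE -!dvdn_divisors ?expn_gt0 ?pgt0 //.
  apply/idP/orP => [/(dvdn_pfactor _ _ p_pr)[i]|[/eqP->//|]].
    rewrite leq_eqVlt => /orP[/eqP-> ->|im ->]; first by left.
    by right; rewrite dvdn_Pexp2l ?prime_gt1.
  by move/dvdn_trans; apply; rewrite dvdn_Pexp2l ?prime_gt1.
by rewrite (perm_big _ perm) big_cons.
Qed.

(** As ['Phi_n] is monic, division works over the integers; the remainder vanishes at [z] but has
    smaller degree than the minimal polynomial of [z] over the rationals, which is ['Phi_n], so it
    is zero. *)
Lemma Cyclotomic_dvd n (z : algC) (q : {poly int}) : n.-primitive_root z ->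
  (map_poly intr q).[z] = 0 -> exists w, q = w * 'Phi_n.
Proof.
move=> prim_z qz0; have Phi_mon := Cyclotomic_monic n.
have Phiz0 : (map_poly intr ('Phi_n)).[z] = 0 :> algC.
  by rewrite (Cintr_Cyclotomic prim_z); apply/eqP; rewrite -/(root _ _) root_cyclotomic.
have /(_ q) := Pdiv.RingMonic.rdivp_eq Phi_mon.
set w := Pdiv.Ring.rdivp _ _; set s := Pdiv.Ring.rmodp _ _ => def_q.
suffices s0: s = 0 by exists w; rewrite {1}def_q s0 addr0.
have sz0: (map_poly intr s).[z] = 0 :> algC.
  by move: qz0; rewrite {1}def_q rmorphD rmorphM hornerD hornerM Phiz0 mulr0 add0r.
have [pf [Dpf mon_pf] dv_pf] := minCpolyP z.
have ratE (t : {poly int}) : map_poly ratr (map_poly intr t) = map_poly intr t :> {poly algC}.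
  by rewrite -map_poly_comp; apply: eq_map_poly => b; rewrite /= ratr_int.
have: pf %| map_poly intr s by rewrite -dv_pf ratE; apply/eqP.
move=> dvd_s; apply/eqP; apply: contraTT (ltnSn (size 'Phi_n)) => s_nz.
have: (size (map_poly intr s : {poly rat}) < size 'Phi_n)%N.
  rewrite size_map_inj_poly //; last exact: intr_inj.
  exact: Pdiv.Ring.ltn_rmodpN0 (monic_neq0 Phi_mon).
have: (size 'Phi_n <= size (map_poly intr s : {poly rat}))%N.
  have <-: size pf = size 'Phi_n.
    rewrite -(size_map_poly (ratr : rat -> algC)) -Dpf (minCpoly_cyclotomic prim_z).
    by rewrite -(Cintr_Cyclotomic prim_z) size_map_inj_poly //; exact: intr_inj.
  apply: dvdp_leq => //; rewrite -size_poly_eq0 size_map_inj_poly ?size_poly_eq0 //.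
  exact: intr_inj.
by move=> h1 /(leq_ltn_trans h1); rewrite ltnn.
Qed.

(* [Phi_(p^(m+1))] divides [sum_(i in S) X^(e i)] and is congruent to [p] modulo
   [X^(p^m) - 1]; reducing modulo the latter makes the class sizes the coefficients. *)
Lemma vanishing_sum_class_dvd p m (z : algC) (I : finType) (S : {set I})
    (e : I -> nat) (j : nat) :
  prime p -> (p ^ m.+1).-primitive_root z -> \sum_(i in S) z ^+ e i = 0 ->
  (p %| #|[set i in S | e i == j %[mod p ^ m]]|)%N.
Proof.
move=> p_pr prim_z sum0; have pgt0 := prime_gt0 p_pr.
have Ngt0 : (0 < p ^ m)%N by rewrite expn_gt0 pgt0.
set N := (p ^ m)%N in Ngt0 *; pose D : {poly int} := 'X^N - 1.
have D_mon : D \is monic by apply: monicXnsubC.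
have [w def_q] : exists w, \sum_(i in S) 'X^(e i) = w * 'Phi_(p ^ m.+1).
  apply: (Cyclotomic_dvd prim_z); rewrite rmorph_sum horner_sum -[RHS]sum0.
  by apply: eq_bigr => i _; rewrite /= map_polyXn hornerXn.
have XnD a : exists v, 'X^a = 'X^(a %% N) + D * v.
  exists ('X^(a %% N) * \sum_(i < a %/ N) 'X^N ^+ i).
  rewrite mulrCA -subrX1 mulrBr mulr1 -exprM -exprD.
  by rewrite {1}(divn_eq a N) addnC mulnC addrC subrK.
have [v0 defPhi] : exists v, 'Phi_(p ^ m.+1) = p%:R + D * v.
  have: 'Phi_(p ^ m.+1) = \sum_(i < p) 'X^N ^+ i.
    apply: (mulIf (monic_neq0 D_mon)); rewrite Cyclotomic_prime_power // mulrC -subrX1.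
    by rewrite -exprM expnSr.
  move->; have ex i : exists v, 'X^N ^+ i = 1 + D * v.
    exists (\sum_(j < i) 'X^N ^+ j); by rewrite -subrX1 addrC subrK.
  exists (\sum_(i < p) \sum_(j < i) 'X^N ^+ j).
  rewrite mulr_sumr -[p%:R](_ : \sum_(i < p) 1 = _); last by rewrite sumr_const card_ord.
  by rewrite -big_split /=; apply: eq_bigr => i _; rewrite -subrX1 addrC subrK.
have [v1 defr] : exists v, \sum_(i in S) 'X^(e i) = \sum_(i in S) 'X^(e i %% N) + D * v.
  elim/big_rec2: _ => [|i x y _ [v ->]]; first by exists 0; rewrite mulr0 addr0.
  by have [u ->] := XnD (e i); exists (u + v); rewrite mulrDr addrACA.
pose Q : {poly int} := \sum_(i in S) ('X^(e i %% N) : {poly int}).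
pose w2 : {poly int} := Pdiv.Ring.rmodp w D.
have eqQ : Q - p%:R * w2 = (w * v0 + p%:R * Pdiv.Ring.rdivp w D - v1) * D.
  have: Q + D * v1 = w * (p%:R + D * v0) by rewrite -defr def_q defPhi.
  move/(canRL (addrK _)) => ->.
  have Dw : Pdiv.Ring.rdivp w D * D = w - w2.
    by rewrite {2}(Pdiv.RingMonic.rdivp_eq D_mon w) addrK.
  have -> : (w * v0 + p%:R * Pdiv.Ring.rdivp w D - v1) * D
      = w * v0 * D + p%:R * (Pdiv.Ring.rdivp w D * D) - v1 * D by ring.
  by rewrite Dw; ring.
have sz_w2 : (size w2 <= N)%N.
  have := Pdiv.Ring.ltn_rmodpN0 w (monic_neq0 D_mon).
  by rewrite size_XnsubC.
have sz_Q : (size Q <= N)%N.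
  apply: (leq_trans (size_sum _ _ _)); apply/bigmax_leqP => i _.
  by rewrite size_polyXn ltn_pmod.
(* Both sides are congruent modulo [D] and have degree below [N], the degree of [D]. *)
have QE : Q = p%:R * w2.
  apply/eqP; rewrite -subr_eq0 eqQ; set y := (_ - v1).
  apply/eqP; apply: contraTeq isT; rewrite mulf_eq0 negb_or => /andP[y0 _].
  have: (size (Q - p%:R * w2)%R <= N)%N.
    apply: (leq_trans (size_polyD _ _)); rewrite size_polyN geq_max sz_Q /=.
    by rewrite -polyC_natr mul_polyC (leq_trans (size_scale_leq _ _)).
  rewrite eqQ size_Mmonic // size_XnsubC // addnS /=.
  by rewrite -[X in (_ <= X)%N]add0n leq_add2r leqn0 size_poly_eq0 (negPf y0).
have : Q`_(j %% N) = #|[set i in S | e i == j %[mod N]]|%:R.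
  rewrite coef_sum -sum1_card natr_sum [in RHS](eq_bigl (fun i => (i \in S) && (e i == j %[mod N]))); last by move=> i; rewrite inE.
  by rewrite big_mkcondr /=; apply: eq_bigr => i _; rewrite coefXn eq_sym; case: eqP.
rewrite QE -polyC_natr mul_polyC coefZ => /(congr1 absz); rewrite abszM !natz /= => <-.
exact: dvdn_mulr.
Qed.

(** * Factorizations of cyclic groups, and units modulo odd prime powers *)

Section CyclicFactor.
Import GroupScope.

(** The pigeonhole rests on [d < p]: at least [p] elements have exponents in one class modulo
    [p ^ m], and such exponents take at most [d] values modulo [p ^ m * d]. Two that agree there
    give equal [p]-th powers, the group having order [p ^ m.+1 * d]. *)
Lemma cyclic_factor_collision (gT : finGroupType) p m d (A B : {set gT}) :
  prime p -> (0 < d < p)%N -> cyclic [set: gT] -> #|gT| = (p ^ m.+1 * d)%N ->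
  {in setX A B &, injective (fun ab : gT * gT => ab.1 * ab.2)} ->
  (#|A| * #|B| = #|gT|)%N ->
  (exists x y, [/\ x \in A, y \in A, x != y & x ^+ p = y ^+ p]) \/
  (exists x y, [/\ x \in B, y \in B, x != y & x ^+ p = y ^+ p]).
Proof.
move=> p_pr /andP[d0 dp] /cyclicP[g defG] cardG injAB cardAB.
have pgt0 := prime_gt0 p_pr.
have og : #[g] = (p ^ m.+1 * d)%N by rewrite orderE -defG cardsT.
have ex (x : gT) : exists i, x == g ^+ i.
  have : x \in <[g]> by rewrite -defG inE.
  by case/cycleP=> i ->; exists i.
pose e (x : gT) := xchoose (ex x); have eP x : x = g ^+ e x by apply/eqP; exact: (xchooseP (ex x)).
have N_gt0 : (0 < p ^ m.+1)%N by rewrite expn_gt0 pgt0.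
have [z prim_z] := C_prim_root_exists N_gt0.
(* A character of order [p ^ m.+1]; as this divides the order of [g], the choice of the exponent
   [e x] is immaterial, which is [chiE]. *)
pose chi (x : gT) : algC := (z ^+ e x)%R.
have chiE i : chi (g ^+ i) = (z ^+ i)%R.
  apply/eqP; rewrite (eq_prim_root_expr prim_z).
  have /eqP := eP (g ^+ i); rewrite eq_expg_mod_order og eq_sym => /eqP eqm.
  by rewrite -(modn_dvdm (e _) (dvdn_mulr d (dvdnn _))) eqm modn_dvdm ?dvdn_mulr.
have chiM x y : chi (x * y) = (chi x * chi y)%R.
  by rewrite {1}(eP x) {1}(eP y) -expgD chiE exprD.
have sum0 : (\sum_(x in [set: gT]) chi x = 0)%R.
  rewrite (eq_bigl xpredT) => [|x]; last by rewrite inE.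
  have : (z * (\sum_x chi x) = \sum_x chi x)%R.
    rewrite [RHS](reindex_inj (mulgI g)) mulr_sumr; apply: eq_bigr => x _.
    by rewrite chiM -[in RHS](expg1 g) chiE expr1.
  move/eqP; rewrite -subr_eq0 -{2}[(\sum_x _)%R]mul1r -mulrBl mulf_eq0 subr_eq0.
  case/orP=> [/eqP z1|/eqP//].
  move: prim_z; rewrite z1 => /prim_order_dvd/(_ 1%N).
  by rewrite expr1 eqxx gtnNdvd // -(exp1n m.+1) ltn_exp2r ?prime_gt1.
have prod0 : ((\sum_(a in A) chi a) * (\sum_(b in B) chi b) = 0)%R.
  rewrite big_distrlr /= pair_big /= -[RHS]sum0.
  (* Injectivity and the count make multiplication onto, so the product of the two sums is the sum
     over the whole group. *)
  have <- : (fun ab : gT * gT => ab.1 * ab.2) @: setX A B = [set: gT].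
    apply/eqP; rewrite eqEcard subsetT /= card_in_imset // cardsX cardAB.
    by rewrite cardsT.
  rewrite big_imset //=; apply: eq_big => [[a b]|[a b] _] /=; first by rewrite in_setX.
  by rewrite chiM.
have ABgt0 : (0 < #|A| * #|B|)%N by rewrite cardAB cardG muln_gt0 N_gt0.
have main (C : {set gT}) : (0 < #|C|)%N -> (\sum_(a in C) chi a = 0)%R ->
    exists x y, [/\ x \in C, y \in C, x != y & x ^+ p = y ^+ p].
  case/card_gt0P=> c0 Cc0 /(vanishing_sum_class_dvd (e c0) p_pr prim_z).
  set K := [set i in C | _] => pK.
  have Kc0 : c0 \in K by rewrite inE Cc0 eqxx.
  have Kp : (p <= #|K|)%N by apply: dvdn_leq pK; apply/card_gt0P; exists c0.
  pose f x := Ordinal (ltn_pmod (e x %/ p ^ m) d0).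
  have : ~~ dinjectiveb f K.
    apply: contraL Kp => /dinjectiveP inj; rewrite -ltnNge (leq_ltn_trans _ dp) //.
    by rewrite -(card_in_imset inj) -[X in (_ <= X)%N](card_ord d) max_card.
  case/dinjectivePn=> x Kx [y]; rewrite inE /= => /andP[xy Ky] [] /eqP feq.
  exists x, y; move: Kx Ky; rewrite !inE => /andP[Cx ex0] /andP[Cy ey0].
  split=> //; first by rewrite eq_sym.
  rewrite {1}(eP x) {1}(eP y) -!expgM; apply/eqP; rewrite eq_expg_mod_order og.
  have split_e u : (e u * p = (e u %/ p ^ m) %/ d * (p ^ m.+1 * d)
      + (e u %/ p ^ m %% d * p ^ m.+1 + e u %% p ^ m * p))%N.
    rewrite {1}(divn_eq (e u) (p ^ m)) {1}(divn_eq (e u %/ p ^ m) d) expnS; ring.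
  by rewrite (split_e x) (split_e y) !modnMDl (eqP feq) (eqP ex0) (eqP ey0).
move/eqP: prod0; rewrite mulf_eq0 => /orP[] /eqP s0; [left|right]; apply: main => //.
  by move: ABgt0; rewrite muln_gt0 => /andP[].
by move: ABgt0; rewrite muln_gt0 => /andP[].
Qed.

(** The units form the automorphism group of a cyclic group of order [p ^ n], which is cyclic for
    odd [p]. *)
Lemma cyclic_units_Zp p n : prime p -> odd p -> (0 < n)%N -> cyclic (units_Zp (p ^ n)).
Proof.
move=> p_pr p_odd n0; set q := (p ^ n)%N.
have q1 : (1 < q)%N by rewrite -(exp1n n) ltn_exp2r // prime_gt1.
pose a : 'Z_q := Zp1.
have oa : #[a] = q by rewrite order_Zp1 Zp_cast.
rewrite -{}oa (isog_cyclic (Zp_unit_isog a)).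
have cG : p.-group <[a]>.
  by rewrite /pgroup -orderE order_Zp1 Zp_cast // pnatX pnat_id ?orbT.
have ntG : <[a]> != 1 by rewrite -cardG_gt1 -orderE order_Zp1 Zp_cast.
have [mm [_ [_ cF _ _]]] := cyclic_pgroup_Aut_structure cG (cycle_cyclic a) ntG.
(* The first case is a cyclic group of order [p]: its automorphism group equals its [p']-core,
   cyclic by [cF]. *)
case: eqP => [_ AF|_ [t [_ _ _]]]; first by move: cF; rewrite -AF.
by rewrite p_odd => -[[]].
Qed.

(** A cyclic group has at most one subgroup of order [p], here generated by [h = 1 + p ^ n.-1].
    Hence [u / v] is a power of [h], and [p h = p]. *)
Lemma units_Zp_expp_inj p n (u v : {unit 'Z_(p ^ n)}) : prime p -> odd p -> (1 < n)%N ->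
  u ^+ p = v ^+ p -> (p%:R * val u = p%:R * val v)%R.
Proof.
move=> p_pr p_odd n1 uv; set q := (p ^ n)%N in u v uv *.
have n0 : (0 < n)%N by apply: ltnW.
have q1 : (1 < q)%N by rewrite -(exp1n n) ltn_exp2r // prime_gt1.
have cycU := cyclic_units_Zp p_pr p_odd n0.
pose t : 'Z_q := ((p ^ n.-1)%:R)%R.
have tt : (t * t = 0)%R.
  rewrite /t -natrM -expnD.
  have -> : (n.-1 + n.-1 = n + n.-2)%N by lia.
  by rewrite expnD natrM pchar_Zp // mul0r.
have pt : (p%:R * t = 0)%R by rewrite /t -natrM -expnS prednK // pchar_Zp.
have Uh : (1 + t)%R \is a GRing.unit.
  apply/unitrP; exists (1 - t)%R; split; ring: tt.
pose h : {unit 'Z_q} := FinRing.Unit Uh.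
have hX i : val (h ^+ i) = (1 + i%:R * t)%R.
  rewrite FinRing.val_unitX /=; elim: i => [|i IH]; first by rewrite mul0r addr0 expr0.
  by rewrite exprS IH -natr1; ring: tt.
have hp : h ^+ p = 1 by apply: val_inj; rewrite hX pt addr0.
have h1 : h != 1.
  rewrite -val_eqE /= -subr_eq0 addrC addKr /t -val_eqE /= val_Zp_nat //.
  rewrite modn_small; first by rewrite -lt0n expn_gt0 prime_gt0.
  by rewrite ltn_exp2l ?prime_gt1 ?prednK.
have oh : #[h] = p by apply: nt_prime_order.
pose w := u * v^-1.
have wp : w ^+ p = 1.
  rewrite expgMn; last by apply: (centsP (units_Zp_abelian q)); rewrite inE.
  by rewrite uv expgVn mulgV.
have : w \in <[h]>.
  have [->|w1] := eqVneq w 1; first by rewrite group1.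
  have ow : #[w] = p by apply: nt_prime_order.
  suff /eqP <- : <[w]> == <[h]> by rewrite cycle_id.
  by rewrite (eq_subG_cyclic cycU) ?subsetT // -!orderE ow oh.
case/cycleP=> i wi; have -> : u = w * v by rewrite mulgKV.
rewrite wi FinRing.val_unitM hX mulrA mulrDr mulr1 [(i%:R * t)%R]mulrC mulrA pt mul0r addr0 //.
Qed.

End CyclicFactor.

(** * Integers as residues and units modulo [t] *)

Lemma Zp_intr_eq0 t (x : int) : (1 < t)%N -> (x%:~R == 0 :> 'Z_t) = (t%:Z %| x)%Z.
Proof.
move=> t1; have nat0 (j : nat) : (j%:R == 0 :> 'Z_t) = (t %| j)%N.
  by rewrite -val_eqE /= val_Zp_nat.
case: (intP x) => [|j|j]; first by rewrite eqxx dvdz0.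
  by rewrite -pmulrn nat0.
by rewrite mulrNz oppr_eq0 -pmulrn nat0 dvdzE abszN.
Qed.

Lemma Zp_intr_eq t (x y : int) : (1 < t)%N ->
  (x%:~R == y%:~R :> 'Z_t) = (t%:Z %| x - y)%Z.
Proof. by move=> t1; rewrite -subr_eq0 -intrB Zp_intr_eq0. Qed.

Lemma Zp_intr_unit t (x : int) : (1 < t)%N ->
  (x%:~R \is a @GRing.unit 'Z_t) = coprimez t x.
Proof.
move=> t1; case: (intP x) => [|j|j]; first by rewrite (unitZpE 0).
  by rewrite -pmulrn unitZpE.
by rewrite mulrNz unitrN -pmulrn unitZpE // coprimezN.
Qed.

(** The default value 1 is taken when [x] is not coprime to [t]; the lemmas below assume
    coprimality. *)
Definition Zp_unit t (x : int) : {unit 'Z_t} := insubd (1%g : {unit 'Z_t}) (x%:~R : 'Z_t).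

Section ZpUnit.
Variable t : nat.
Hypothesis t1 : (1 < t)%N.

Lemma val_Zp_unit x : coprimez t x -> val (Zp_unit t x) = x%:~R.
Proof. by move=> tx; rewrite val_insubd Zp_intr_unit // tx. Qed.

Lemma Zp_unitM x y : coprimez t x -> coprimez t y ->
  Zp_unit t (x * y) = (Zp_unit t x * Zp_unit t y)%g.
Proof.
move=> tx ty; apply: val_inj; rewrite FinRing.val_unitM !val_Zp_unit ?intrM //.
by rewrite coprimezMr tx.
Qed.

Lemma Zp_unit_eq x y : coprimez t x -> coprimez t y ->
  (Zp_unit t x == Zp_unit t y) = (t%:Z %| x - y)%Z.
Proof. by move=> tx ty; rewrite -val_eqE /= !val_Zp_unit // Zp_intr_eq. Qed.

Lemma Zp_unitX x i : coprimez t x -> Zp_unit t (x ^+ i) = (Zp_unit t x ^+ i)%g.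
Proof.
move=> tx; apply: val_inj; rewrite FinRing.val_unitX !val_Zp_unit ?rmorphXn //.
by rewrite coprimezXr.
Qed.

End ZpUnit.

Lemma coprimez_pfactor p n x : prime p -> (0 < n)%N ->
  coprimez (p ^ n)%N x = ~~ (p %| x)%Z.
Proof. by move=> p_pr n0; rewrite /coprimez /gcdz dvdzE /= eqz_nat -/(coprime _ _) coprime_pexpl // prime_coprime. Qed.

Lemma card_unit_Zp_pfactor p n : prime p -> (0 < n)%N ->
  #|units_Zp (p ^ n)| = (p.-1 * p ^ n.-1)%N.
Proof.
move=> p_pr n0; rewrite -(totient_pfactor p_pr n0) -card_units_Zp ?expn_gt0 ?prime_gt0 //.
Qed.

(** Each of the [m] blocks of [p] consecutive integers contains exactly one integer congruent to [c]
    modulo [p]. *)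
Lemma card_non_multiples p m (c : int) : (0 < p)%N ->
  #|[set i : 'I_(m * p) | ~~ (p %| i%:Z - c)%Z]| = (m * p.-1)%N.
Proof.
move=> p0; pose P (i : nat) := (p %| i%:Z - c)%Z.
have cnt : #|[set i : 'I_(m * p) | P i]| = m.
  rewrite -sum1dep_card -(big_mkord P (fun=> 1%N)).
  elim: m => [|m IH]; first by rewrite big_geq.
  rewrite mulSn addnC (@big_cat_nat _ _ _ (m * p)) ?leq_addr //= IH.
  rewrite -{1}[(m * p)%N]add0n big_addn addKn big_mkord.
  pose j0 := `|(c %% p)%Z|%N.
  have j0p : (j0 < p)%N by rewrite /j0; have := @ltz_pmod c p; have := @modz_ge0 c p; lia.
  have j0E : (p %| j0%:Z - c)%Z.
    rewrite -eqz_mod_dvd /j0 gez0_abs ?modz_ge0 ?modz_mod //; lia.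
  rewrite (big_pred1 (Ordinal j0p)) ?addn1 // => i; rewrite /P /=.
  have -> : (p %| (i + m * p)%N%:Z - c)%Z = (p %| i%:Z - j0%:Z)%Z.
    have -> : (i + m * p)%N%:Z - c = (i%:Z - j0%:Z) + (m%:Z * p%:Z + (j0%:Z - c)) by lia.
    by rewrite rpredDr // rpredD // dvdz_mull.
  rewrite -eqz_mod_dvd !modz_nat eqz_nat !modn_small //.
have := cardsC [set i : 'I_(m * p) | P i].
rewrite cnt card_ord => E; rewrite -subn1 mulnBr muln1 -[in RHS]E addKn.
by apply: eq_card => i; rewrite !inE.
Qed.

(** * Perfect splitter sets and the covering of nonzero residues *)

Section PerfectSplitter.
Variables k1 k2 q : nat.
Variable B : {set 'I_q}.
Hypothesis perfB : perfect_splitter k1 k2 B.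

Lemma perfect_splitter_inj (a a' : int) (b b' : 'I_q) :
  intv_star (- k1%:Z) k2%:Z a -> intv_star (- k1%:Z) k2%:Z a' -> b \in B -> b' \in B ->
  (q%:Z %| a * (b : nat)%:Z - a' * (b' : nat)%:Z)%Z -> a = a' /\ b = b'.
Proof.
case: perfB => -[spl disj _] Ma Ma' Bb Bb'; rewrite -eqz_mod_dvd => /eqP E.
have [bb'|bb'] := eqVneq b b'; last by have := disj _ _ Bb Bb' bb' _ _ Ma Ma'; rewrite /resq E eqxx.
by split=> //; subst b'; apply: (spl b Bb).2.
Qed.

(** A finite index type for the whole interval [[-k1, k2]]; the index [k1] gives 0, which has to be
    excluded separately. *)
Definition mult_val (i : 'I_(k1 + k2).+1) : int := i%:Z - k1%:Z.

Lemma mult_valP i : mult_val i != 0 -> intv_star (- k1%:Z) k2%:Z (mult_val i).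
Proof. by rewrite /intv_star /mult_val => ->; have := ltn_ord i; lia. Qed.

(** The products are distinct and nonzero, and perfection makes their number [q - 1]. *)
Lemma perfect_splitter_cover (x : 'Z_q) : (1 < q)%N -> x != 0 ->
  exists i b, [/\ mult_val i != 0, b \in B & x = (mult_val i * (b : nat)%:Z)%:~R].
Proof.
move=> q1 x0.
pose F (ib : 'I_(k1 + k2).+1 * 'I_q) : 'Z_q := (mult_val ib.1 * (ib.2 : nat)%:Z)%:~R.
pose D := setX [set i | mult_val i != 0] B.
have injF : {in D &, injective F}.
  move=> [i b] [i' b']; rewrite !in_setX !inE => /andP[i0 Bb] /andP[i'0 Bb'].
  move/eqP; rewrite Zp_intr_eq //.
  case/(perfect_splitter_inj (mult_valP i0) (mult_valP i'0) Bb Bb') => ii' ->.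
  congr (_, _); apply: val_inj; move: ii'; rewrite /mult_val /=; lia.
have card_mult : #|[set i | mult_val i != 0]| = (k1 + k2)%N.
  have k1lt : (k1 < (k1 + k2).+1)%N by lia.
  rewrite (_ : [set i | _] = [set~ Ordinal k1lt]) ?cardsC1 ?card_ord //.
  by apply/setP=> i; rewrite !inE -val_eqE /mult_val subr_eq0.
have : F @: D = [set~ 0].
  apply/eqP; rewrite eqEcard; apply/andP; split.
    apply/subsetP=> _ /imsetP[[i b] Dib ->]; move: Dib; rewrite in_setX !inE => /andP[i0 Bb].
    rewrite Zp_intr_eq0 //; have := (perfB.1.1 b Bb).1 _ (mult_valP i0).
    by apply: contra => /dvdz_mod0P E; rewrite /resq E.
  rewrite card_in_imset // cardsX card_mult mulnC perfB.2 cardsC1 card_ord.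
  by rewrite Zp_cast // subn1.
move/setP/(_ x); rewrite !inE x0 => /imsetP[[i b]]; rewrite in_setX inE => /andP[i0 Bb] ->.
by exists i, b.
Qed.

End PerfectSplitter.

(** * Factorization of the unit group modulo a prime power *)

Section PrimePower.
Variables k1 k2 p n : nat.
Hypotheses (p_pr : prime p) (n_gt0 : (0 < n)%N).
Local Notation q := (p ^ n)%N.
Variable B : {set 'I_q}.
Hypothesis perfB : perfect_splitter k1 k2 B.

Definition unit_mults : {set 'I_(k1 + k2).+1} := [set i | ~~ (p %| mult_val i)%Z].
Definition unit_elts : {set 'I_q} := [set b in B | ~~ (p %| b)%N].

Definition mult_units := [set Zp_unit q (mult_val i) | i in unit_mults].
Definition elt_units := [set Zp_unit q (b : nat)%:Z | b : 'I_q in unit_elts].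

Let q_gt1 : (1 < q)%N. Proof. by rewrite -(exp1n n) ltn_exp2r // prime_gt1. Qed.

Lemma unit_mults_neq0 i : i \in unit_mults -> mult_val i != 0.
Proof. by rewrite inE; apply: contra => /eqP ->; rewrite dvdz0. Qed.

Lemma unit_mults_coprime i : i \in unit_mults -> coprimez q (mult_val i).
Proof. by rewrite inE coprimez_pfactor. Qed.

Lemma unit_elts_coprime b : b \in unit_elts -> coprimez q (b : nat)%:Z.
Proof. by rewrite inE coprimez_pfactor // => /andP[]. Qed.

Lemma unit_elts_sub b : b \in unit_elts -> b \in B.
Proof. by rewrite inE => /andP[]. Qed.

Lemma units_mul_inj i i' b b' : i \in unit_mults -> i' \in unit_mults ->
  b \in unit_elts -> b' \in unit_elts ->
  (Zp_unit q (mult_val i) * Zp_unit q (b : nat)%:Z =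
   Zp_unit q (mult_val i') * Zp_unit q (b' : nat)%:Z)%g -> i = i' /\ b = b'.
Proof.
move=> Mi Mi' Bb Bb'.
have [ci ci'] := (unit_mults_coprime Mi, unit_mults_coprime Mi').
have [cb cb'] := (unit_elts_coprime Bb, unit_elts_coprime Bb').
rewrite -!Zp_unitM // => /eqP; rewrite Zp_unit_eq ?coprimezMr ?ci ?ci' //.
case/(perfect_splitter_inj perfB (mult_valP (unit_mults_neq0 Mi))
  (mult_valP (unit_mults_neq0 Mi')) (unit_elts_sub Bb) (unit_elts_sub Bb')) => ii' ->.
by split=> //; apply: val_inj; move: ii'; rewrite /mult_val /=; lia.
Qed.

Lemma units_factor_inj :
  {in setX mult_units elt_units &, injective (fun ab => ab.1 * ab.2)%g}.
Proof.
move=> [x y] [x' y']; rewrite !in_setX /= => /andP[/imsetP[i Mi ->] /imsetP[b Bb ->]].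
case/andP=> /imsetP[i' Mi' ->] /imsetP[b' Bb' ->].
by case/units_mul_inj => // -> ->.
Qed.

(** A product is a unit only if both factors are, so the representation of a unit by the perfect set
    uses only [unit_mults] and [unit_elts]. *)
Lemma units_factor_card : (#|mult_units| * #|elt_units| = #|units_Zp q|)%N.
Proof.
rewrite -cardsX -(card_in_imset units_factor_inj); apply: eq_card => u.
rewrite [RHS]inE; apply/imsetP.
have u0 : val u != 0 by apply: contraTneq (valP u) => ->; rewrite unitr0.
have [i [b [i0 Bb uE]]] := perfect_splitter_cover perfB q_gt1 u0.
have := valP u; rewrite /= uE Zp_intr_unit // coprimezMr => /andP[ci cb].
have Mi : i \in unit_mults by rewrite inE -(@coprimez_pfactor _ n).
have Bb0 : b \in unit_elts by move: cb; rewrite coprimez_pfactor // inE Bb.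
exists (Zp_unit q (mult_val i), Zp_unit q (b : nat)%:Z).
  by rewrite in_setX /=; apply/andP; split; apply/imsetP; [exists i | exists b].
by rewrite /= -Zp_unitM //; apply: val_inj; rewrite val_Zp_unit // coprimezMr ci.
Qed.

Lemma units_gt0 : (0 < #|mult_units|)%N /\ (0 < #|elt_units|)%N.
Proof. by apply/andP; rewrite -muln_gt0 units_factor_card cardG_gt0. Qed.

Lemma card_elt_units : #|elt_units| = #|unit_elts|.
Proof.
have [/card_gt0P[_ /imsetP[i Mi _]] _] := units_gt0.
apply: card_in_imset => b b' Bb Bb' E.
by have [] := units_mul_inj Mi Mi Bb Bb' (congr1 _ E).
Qed.

Lemma card_mult_units : #|mult_units| = #|unit_mults|.
Proof.
have [_ /card_gt0P[_ /imsetP[b Bb _]]] := units_gt0.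
apply: card_in_imset => i i' Mi Mi' E.
by have [] := units_mul_inj Mi Mi' Bb Bb (congr1 (mulg^~ _) E).
Qed.

(** Multiplied by [p.-1], both sides count the units modulo [p ^ n]. The equation makes [m] divide a
    power of [p]. *)
Lemma card_unit_elts m : (k1 + k2).+1 = (m * p)%N -> (m * #|unit_elts| = p ^ n.-1)%N.
Proof.
move=> km; apply/eqP; rewrite -(eqn_pmul2l (_ : 0 < p.-1)%N); last by have := prime_gt1 p_pr; lia.
rewrite -card_unit_Zp_pfactor // -units_factor_card card_mult_units card_elt_units.
rewrite mulnA; apply/eqP; congr (_ * _)%N; rewrite mulnC -(card_non_multiples m k1 (prime_gt0 p_pr)).
rewrite /unit_mults /mult_val; move: (k1 : int) => c; by rewrite -km.
Qed.

End PrimePower.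

(** Multiplication by [p ^ j] lifts a congruence modulo [p ^ t] to one modulo [p ^ n], where the
    splitter property applies. *)
Lemma perfect_splitter_scaled_inj k1 k2 p n t j (B : {set 'I_(p ^ n)}) (a a' : int) b b' :
  prime p -> perfect_splitter k1 k2 B -> (t + j = n)%N ->
  intv_star (- k1%:Z) k2%:Z ((p ^ j)%N%:Z * a) ->
  intv_star (- k1%:Z) k2%:Z ((p ^ j)%N%:Z * a') ->
  b \in B -> b' \in B ->
  ((p ^ t)%N%:Z %| a * (b : nat)%:Z - a' * (b' : nat)%:Z)%Z -> a = a' /\ b = b'.
Proof.
move=> p_pr perfB tj Ma Ma' Bb Bb' dvd_t.
have pj0 : (p ^ j)%N%:Z != 0 by rewrite eqz_nat expn_eq0 -leqn0 leqNgt prime_gt0.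
have dvd_n : ((p ^ n)%N%:Z %| (p ^ j)%N%:Z * a * (b : nat)%:Z - (p ^ j)%N%:Z * a' * (b' : nat)%:Z)%Z.
  by rewrite -!mulrA -mulrBr -[X in (X %| _)%Z](congr1 (fun k => (p ^ k)%N%:Z) tj) expnD mulnC PoszM dvdz_mul.
by have [/(mulfI pj0) -> ->] := perfect_splitter_inj perfB Ma Ma' Bb Bb' dvd_n.
Qed.

(** * Odd primes *)

Lemma odd_perfect_splitter_absurd k1 k2 p n r (B : {set 'I_(p ^ n)}) :
  prime p -> odd p -> (k1 <= k2)%N -> (k1 + k2).+1 = (p ^ r)%N -> (1 < r < n)%N ->
  ~ perfect_splitter k1 k2 B.
Proof.
move=> p_pr p_odd k12 kr /andP[r1 rn] perfB.
have p1 := prime_gt1 p_pr; have n1 : (1 < n)%N by apply: ltn_trans rn.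
have n0 : (0 < n)%N by apply: ltnW.
have q1 : (1 < p ^ n)%N by rewrite -(exp1n n) ltn_exp2r.
have p0 : p%:Z != 0 by rewrite eqz_nat -lt0n prime_gt0.
have pow (u v : int) : coprimez (p ^ n)%N u -> coprimez (p ^ n)%N v ->
    (Zp_unit (p ^ n) u ^+ p = Zp_unit (p ^ n) v ^+ p)%g ->
    ((p ^ n.-1)%N%:Z %| u - v)%Z.
  move=> cu cv /(units_Zp_expp_inj p_pr p_odd n1); rewrite !val_Zp_unit //.
  rewrite !pmulrn -!intrM => /eqP; rewrite Zp_intr_eq // -mulrBr.
  by rewrite -{1}(prednK n0) expnS PoszM dvdz_mul2l.
have cardU : #|{: {unit 'Z_(p ^ n)}}| = (p ^ n.-2.+1 * p.-1)%N.
  by rewrite -cardsT card_unit_Zp_pfactor // mulnC; congr (p ^ _ * _)%N; lia.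
have cardAC : (#|mult_units k1 k2 p n| * #|elt_units B| = #|{: {unit 'Z_(p ^ n)}}|)%N.
  by rewrite units_factor_card // cardsT.
have p1p : (0 < p.-1 < p)%N by lia.
have := cyclic_factor_collision p_pr p1p (cyclic_units_Zp p_pr p_odd n0) cardU
  (units_factor_inj p_pr n0 perfB) cardAC.
case.
- case=> _ [_ [/imsetP[i Mi ->] /imsetP[i' Mi' ->] neq /pow]].
  move/(_ (unit_mults_coprime p_pr n0 Mi) (unit_mults_coprime p_pr n0 Mi')).
  (* Since [r < n], the interval has at most [p ^ n.-1] integers, so congruent multipliers are
     equal. *)
  have lt_n1 : ((k1 + k2).+1 <= p ^ n.-1)%N by rewrite kr leq_exp2l //; lia.
  have [li li'] := (ltn_ord i, ltn_ord i').
  move=> dv; case/negP: neq; apply/eqP; congr (Zp_unit _ _); apply/eqP.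
  rewrite -subr_eq0; apply: contraTT dv => nz.
  rewrite dvdzE gtnNdvd ?absz_gt0 //; rewrite /mult_val.
  by move: (p ^ n.-1)%N lt_n1 => *; lia.
- case=> _ [_ [/imsetP[b Bb ->] /imsetP[b' Bb' ->] neq /pow]].
  move/(_ (unit_elts_coprime p_pr n0 Bb) (unit_elts_coprime p_pr n0 Bb')).
  (* As [p ^ 2 <= k1 + k2 + 1 <= 2 k2 + 1], the integer [p] is a multiplier, and it separates the
     elements of [B] modulo [p ^ n.-1]. *)
  have pk2 : (p <= k2)%N.
    have : (p * p <= p ^ r)%N by rewrite mulnn leq_exp2l.
    rewrite -kr; nia.
  have M1 : intv_star (- k1%:Z) k2%:Z ((p ^ 1)%N%:Z * 1).
    by rewrite expn1 mulr1 /intv_star; lia.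
  rewrite -[X in (_ %| X - _)%Z]mul1r -[X in (_ %| _ - X)%Z]mul1r.
  have n1E : (n.-1 + 1 = n)%N by lia.
  case/(perfect_splitter_scaled_inj p_pr perfB n1E M1 M1 (unit_elts_sub Bb) (unit_elts_sub Bb')).
  by move=> _ bb; rewrite bb eqxx in neq.
Qed.

(** * Powers and dilates of odd residues modulo powers of 2 *)

Lemma Euclid_dvdzM p (x y : int) : prime p -> (p %| x * y)%Z = (p %| x)%Z || (p %| y)%Z.
Proof. by move=> p_pr; rewrite !dvdzE abszM Euclid_dvdM. Qed.

(** Each squaring raises the exact power of 2 in the difference by one: [(y + 2^v o)^2 = y^2 +
    2^(v+1) (y o + 2^(v-1) o^2)], where [v > 1] keeps the last factor odd. *)
Lemma expn2_difference (x y o : int) w i : (1 < w)%N ->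
  ~~ (2 %| y)%Z -> ~~ (2 %| o)%Z -> x = y + (2 ^ w)%N%:Z * o ->
  ((2 ^ (w + i).+1)%N%:Z %| x ^+ (2 ^ i) - y ^+ (2 ^ i) * (1 + (2 ^ (w + i))%N%:Z))%Z.
Proof.
move=> w1 y_odd o_odd xE.
have [o' [y' [o'_odd y'_odd -> ->]]] : exists o' y', [/\ ~~ (2 %| o')%Z, ~~ (2 %| y')%Z,
    y ^+ (2 ^ i) = y' & x ^+ (2 ^ i) = y' + (2 ^ (w + i))%N%:Z * o'].
  elim: i => [|i [o' [y' [o'_odd y'_odd yE xE']]]].
    by exists o, y; rewrite !expr1 addn0.
  have wE : (w + i = (w + i).-2.+2)%N by lia.
  set v := (w + i).-2 in wE.
  exists (y' * o' + 2 * (2 ^ v)%N%:Z * o' * o'), (y' ^+ 2).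
  split.
  - have : ~~ (2 %| y' * o')%Z by rewrite Euclid_dvdzM // negb_or y'_odd.
    by rewrite -!mulrA; move: (y' * o') (_ * (o' * o')) => u u'; lia.
  - by rewrite expr2 Euclid_dvdzM // negb_or y'_odd.
  - by rewrite expnSr exprM yE.
  - rewrite expnSr exprM xE' addnS wE !expnS !PoszM; ring.
have -> : y' + (2 ^ (w + i))%N%:Z * o' - y' * (1 + (2 ^ (w + i))%N%:Z)
  = (2 ^ (w + i))%N%:Z * (o' - y') by ring.
rewrite expnSr PoszM dvdz_mul //.
move: o'_odd y'_odd; lia.
Qed.

Section Dilates.
Variables (t q : nat) (E : {set 'I_q}).
Hypotheses (t_gt0 : (0 < t)%N) (E_odd : forall b, b \in E -> ~~ (2 %| (b : nat)%:Z)%Z).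

(** The exponent [s] is kept apart from [t]: injectivity modulo [2 ^ t] serves to cover the units,
    and modulo [2 ^ t.-1] to reach the contradiction. *)
Definition dilates_inj s (L : seq int) := forall a a' (b b' : 'I_q),
  a \in L -> a' \in L -> b \in E -> b' \in E ->
  ((2 ^ s)%N%:Z %| a * (b : nat)%:Z - a' * (b' : nat)%:Z)%Z -> a = a' /\ b = b'.

Definition dilates (L : seq int) : {set {unit 'Z_(2 ^ t)}} :=
  [set Zp_unit (2 ^ t) (nth 0 L ib.1 * (ib.2 : nat)%:Z)
     | ib : 'I_(size L) * 'I_q in setX [set: 'I_(size L)] E].

Let t1 : (1 < 2 ^ t)%N. Proof. exact: leq_pexp2l (isT : 0 < 2)%N t_gt0. Qed.

Lemma dilatesP L u : reflect (exists a b, [/\ a \in L, b \in E & u = Zp_unit (2 ^ t) (a * (b : nat)%:Z)])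
  (u \in dilates L).
Proof.
apply: (iffP imsetP) => [[[i b]]|[a [b [aL Eb ->]]]].
  by rewrite in_setX => /andP[_ Eb] ->; exists (nth 0 L i), b; rewrite mem_nth.
have iL : (index a L < size L)%N by rewrite index_mem.
by exists (Ordinal iL, b); rewrite ?in_setX ?inE //= nth_index.
Qed.

Section Odd.
Variable L : seq int.
Hypothesis L_odd : forall a, a \in L -> ~~ (2 %| a)%Z.

Lemma dilate_coprime a b : a \in L -> b \in E -> coprimez (2 ^ t)%N (a * (b : nat)%:Z).
Proof. by move=> aL Eb; rewrite coprimez_pfactor // Euclid_dvdzM // negb_or L_odd ?E_odd. Qed.

(** There are [2 ^ t.-1] units modulo [2 ^ t], as many as there are distinct products. *)
Lemma dilates_cover x : uniq L -> dilates_inj t L -> (size L * #|E| = 2 ^ t.-1)%N ->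
  ~~ (2 %| x)%Z ->
  exists a b, [/\ a \in L, b \in E & ((2 ^ t)%N%:Z %| x - a * (b : nat)%:Z)%Z].
Proof.
move=> uL inj cardE x_odd.
have cx : coprimez (2 ^ t)%N x by rewrite coprimez_pfactor.
have : Zp_unit (2 ^ t) x \in dilates L.
  suff -> : dilates L = units_Zp (2 ^ t) by rewrite inE.
  apply/eqP; rewrite eqEcard subsetT card_unit_Zp_pfactor // mul1n -cardE.
  rewrite card_in_imset ?cardsX ?cardsT ?card_ord ?leqnn //.
  move=> [i b] [i' b']; rewrite !in_setX /= => /andP[_ Eb] /andP[_ Eb'] /eqP.
  rewrite Zp_unit_eq ?dilate_coprime ?mem_nth //.
  case/inj => //; rewrite ?mem_nth // => /eqP.
  by rewrite nth_uniq // => /eqP ii' ->; congr (_, _); apply: val_inj.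
case/dilatesP=> a [b [aL Eb /eqP]]; rewrite Zp_unit_eq ?dilate_coprime // => xE.
by exists a, b.
Qed.

(* The hypotheses make the set of products stable under [1 + 2^(t-1)], which sends
   one product to a different one that agrees with it modulo [2^(t-1)]. *)
Lemma dilates_stable_absurd x y m : (0 < size L)%N -> (0 < #|E|)%N ->
  dilates_inj t.-1 L -> ~~ (2 %| x)%Z -> ~~ (2 %| y)%Z -> (1 < t)%N ->
  (forall a b, a \in L -> b \in E -> exists a' b', [/\ a' \in L, b' \in E &
     ((2 ^ t)%N%:Z %| x * (a * (b : nat)%:Z) - y * (a' * (b' : nat)%:Z))%Z]) ->
  ~ ((2 ^ t)%N%:Z %| x ^+ m - y ^+ m * (1 + (2 ^ t.-1)%N%:Z))%Z.
Proof.
move=> L0 /card_gt0P[b0 Eb0] inj x_odd y_odd t2 stab dvd_m.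
have cx : coprimez (2 ^ t)%N x by rewrite coprimez_pfactor.
have cy : coprimez (2 ^ t)%N y by rewrite coprimez_pfactor.
have ch : coprimez (2 ^ t)%N (1 + (2 ^ t.-1)%N%:Z).
  rewrite coprimez_pfactor //; have -> : t.-1 = t.-2.+1 by lia.
  by rewrite expnS PoszM; lia.
have cM z a b : coprimez (2 ^ t)%N z -> a \in L -> b \in E ->
    coprimez (2 ^ t)%N (z * (a * (b : nat)%:Z)).
  by move=> cz aL Eb; rewrite coprimezMr cz dilate_coprime.
pose u := ((Zp_unit (2 ^ t) y)^-1 * Zp_unit (2 ^ t) x)%g.
have comm := (centsP (units_Zp_abelian (2 ^ t))).
(* The stability hypothesis gives one inclusion, and equal cardinality gives equality. *)
have uT : (u *: dilates L)%g = dilates L.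
  apply/eqP; rewrite eqEcard card_lcoset leqnn andbT.
  apply/subsetP=> _ /lcosetP[_ /dilatesP[a [b [aL Eb ->]]] ->].
  have [a' [b' [aL' Eb' dvd_t]]] := stab _ _ aL Eb.
  apply/dilatesP; exists a', b'; split=> //.
  rewrite /u -mulgA; apply: (canLR (mulKg _)); rewrite -!Zp_unitM ?dilate_coprime //.
  by apply/eqP; rewrite Zp_unit_eq ?cM.
have uTm : (u ^+ m *: dilates L)%g = dilates L.
  by elim: m {dvd_m} => [|m IH]; rewrite ?expg0 ?lcoset1 // expgS lcosetM IH.
have umE : (u ^+ m)%g = Zp_unit (2 ^ t) (1 + (2 ^ t.-1)%N%:Z).
  rewrite /u expgMn; last by apply: comm; rewrite inE.
  rewrite expgVn; apply: (canLR (mulKg _)); rewrite -!Zp_unitX // -Zp_unitM ?coprimezXr //.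
  by apply/eqP; rewrite Zp_unit_eq ?coprimezXr // coprimezMr coprimezXr.
have a0L := mem_nth 0 L0; set a0 := nth 0 L 0 in a0L.
have /dilatesP[a [b [aL Eb /eqP]]] :
    (Zp_unit (2 ^ t) (1 + (2 ^ t.-1)%N%:Z) * Zp_unit (2 ^ t) (a0 * (b0 : nat)%:Z))%g \in dilates L.
  by rewrite -uTm umE mem_lcoset mulKg; apply/dilatesP; exists a0, b0.
rewrite -Zp_unitM ?dilate_coprime // Zp_unit_eq ?cM ?dilate_coprime //.
have tE : (2 ^ t = 2 ^ t.-1 * 2)%N by rewrite -expnSr prednK.
rewrite tE PoszM => dvd_t.
(* Modulo [2 ^ t.-1] the factor [1 + 2 ^ t.-1] disappears, so the two products coincide; modulo
   [2 ^ t] the odd number [a0 b0] would then be even. *)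
have [eqa eqb] : a0 = a /\ b0 = b.
  apply: inj => //; have := dvdz_trans (dvdz_mulr _ (dvdzz _)) dvd_t.
  rewrite mulrDl mul1r addrAC rpredDr //.
  by rewrite dvdz_mulr.
move: dvd_t; rewrite -eqa -eqb mulrDl mul1r addrAC subrr add0r dvdz_mul2l //.
  by rewrite Euclid_dvdzM // -[X in _ || X]negbK E_odd // -[X in X || _]negbK L_odd.
by rewrite eqz_nat expn_eq0.
Qed.

End Odd.

End Dilates.

(** * The prime 2, in three cases according to the size of [k1] *)

Lemma two_perfect_splitter_absurd k1 k2 n r (B : {set 'I_(2 ^ n)}) :
  (k1 <= k2)%N -> (k1 + k2).+1 = (2 ^ r)%N -> (2 < r)%N -> (r.+1 < n)%N ->
  ~ perfect_splitter k1 k2 B.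
Proof.
move=> k12 kr r2 rn perfB; have p_pr : prime 2 by [].
have n0 : (0 < n)%N by lia.
pose E := unit_elts B.
have E_odd b : b \in E -> ~~ (2 %| (b : nat)%:Z)%Z by rewrite inE => /andP[].
have cardE : #|E| = (2 ^ (n - r))%N.
  have := @card_unit_elts k1 k2 2 n p_pr n0 B perfB (2 ^ r.-1).
  rewrite -expnSr prednK ?kr; last by lia.
  move=> /(_ erefl) /eqP; rewrite (_ : n.-1 = r.-1 + (n - r))%N; last by lia.
  by rewrite expnD eqn_pmul2l ?expn_gt0 // => /eqP.
have E0 : (0 < #|E|)%N by rewrite cardE expn_gt0.
have inj j t L : (t + j = n)%N ->
    (forall a, a \in L -> intv_star (- k1%:Z) k2%:Z ((2 ^ j)%N%:Z * a)) -> dilates_inj E t L.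
  move=> tj LM a a' b b' aL aL' Eb Eb'.
  by apply: (perfect_splitter_scaled_inj p_pr perfB tj); rewrite ?LM ?(unit_elts_sub Eb) ?(unit_elts_sub Eb').
have dvd3 t (x : int) : ((2 ^ t)%N%:Z %| 3 * x)%Z = ((2 ^ t)%N%:Z %| x)%Z.
  by rewrite Gauss_dvdzr // /coprimez /gcdz /= eqz_nat -/(coprime _ _) coprimeXl.
have memL1 (a : int) : a \in [:: 1 : int] -> a = 1 by rewrite inE => /eqP.
(* In the first case [k2 >= 3 * 2 ^ (r - 2)], so [2 ^ (r - 2)] times 1 or 3 is a multiplier. *)
have [k1_lt|k1_ge] := ltnP k1 (2 ^ (r - 2)).
  pose t := (n - r + 2)%N.
  have P0 : (0 < 2 ^ (r - 2))%N by rewrite expn_gt0.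
  have rE : (2 ^ r = 4 * 2 ^ (r - 2))%N by rewrite -(expnD 2 2) subnKC // ltnW.
  have inj13 : dilates_inj E t [:: 1; 3].
    apply: (inj (r - 2)%N); first by rewrite /t; lia.
    by move=> a; rewrite !inE /intv_star => /orP[]/eqP ->; lia.
  have inj1 : dilates_inj E t.-1 [:: 1].
    apply: (inj (r - 1)%N); first by rewrite /t; lia.
    have -> : (r - 1 = (r - 2).+1)%N by lia.
    by move=> a /memL1 ->; rewrite /intv_star expnS; lia.
  have odd13 a : a \in [:: 1; 3] -> ~~ (2 %| a)%Z by rewrite !inE => /orP[]/eqP->.
  have t4 : (3 < t)%N by rewrite /t; lia.
  have t0 : (0 < t)%N by lia.
  have card13 : (2 * #|E| = 2 ^ t.-1)%N.
    by rewrite cardE -expnS; congr (2 ^ _)%N; rewrite /t; lia.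
  (* From [9 = 1 + 2 ^ 3], [t - 4] squarings raise the exponent 3 to [t - 1]; [r.+1 < n] ensures
     [t >= 4]. *)
  have diff : ((2 ^ t)%N%:Z %| 9 ^+ (2 ^ (t - 4)) - 1 ^+ (2 ^ (t - 4)) * (1 + (2 ^ t.-1)%N%:Z))%Z.
    have := @expn2_difference 9 1 1 3 (t - 4) isT isT isT erefl.
    by rewrite (_ : 3 + (t - 4) = t.-1)%N ?prednK //; lia.
  move: diff; apply: (@dilates_stable_absurd t _ E t0 E_odd [:: 1]) => //.
  - by move=> a /memL1 ->.
  - lia.
  move=> _ b /memL1 -> Eb.
  have o9b : ~~ (2 %| 9 * (b : nat)%:Z)%Z by have := E_odd b Eb; lia.
  have [a [b' [aL Eb' dv]]] := dilates_cover t0 E_odd odd13 isT inj13 card13 o9b.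
  move: aL dv; rewrite !inE => /orP[] /eqP -> dv.
    by exists 1, b'; split=> //; rewrite !mul1r; rewrite mul1r in dv.
  (* The coefficient 3 is excluded: cancelling it would make the distinct products [3 b] and [b']
     congruent. *)
  have dv3 : ((2 ^ t)%N%:Z %| 3 * (b : nat)%:Z - 1 * (b' : nat)%:Z)%Z.
    rewrite -dvd3; move: dv; congr (_ %| _)%Z; ring.
  by have [] := inj13 3 1 b b' isT isT Eb Eb' dv3.
pose t := (n - r + 3)%N.
have P0 : (0 < 2 ^ (r - 3))%N by rewrite expn_gt0.
have rE : (2 ^ r = 8 * 2 ^ (r - 3))%N by rewrite -(expnD 2 3) subnKC.
have r3E : (2 ^ (r - 2) = 2 * 2 ^ (r - 3))%N by rewrite -expnS; congr (2 ^ _)%N; lia.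
have t5 : (4 < t)%N by rewrite /t; lia.
have t0 : (0 < t)%N by lia.
have inj2 : dilates_inj E t.-1 [:: 1; -1].
  apply: (inj (r - 2)%N); first by rewrite /t; lia.
  by move=> a; rewrite !inE /intv_star => /orP[]/eqP ->; lia.
have card4 : (4 * #|E| = 2 ^ t.-1)%N.
  by rewrite cardE -(expnD 2 2); congr (2 ^ _)%N; rewrite /t; lia.
have [k1_lt|k1_ge3] := ltnP k1 (3 * 2 ^ (r - 3)).
  have inj4 : dilates_inj E t [:: 1; -1; 3; 5].
    apply: (inj (r - 3)%N); first by rewrite /t; lia.
    by move=> a; rewrite !inE /intv_star => /or4P[]/eqP ->; lia.
  have odd4 a : a \in [:: 1; -1; 3; 5] -> ~~ (2 %| a)%Z by rewrite !inE => /or4P[]/eqP->.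
  have diff : ((2 ^ t)%N%:Z %| 9 ^+ (2 ^ (t - 5)) - 25 ^+ (2 ^ (t - 5)) * (1 + (2 ^ t.-1)%N%:Z))%Z.
    have := @expn2_difference 9 25 (-1) 4 (t - 5) isT isT isT erefl.
    by rewrite (_ : 4 + (t - 5) = t.-1)%N ?prednK //; lia.
  (* Every coefficient other than 5 would give two congruent products. Two such steps multiply by
     [9 / 25], where [9 = 25 - 2 ^ 4]. *)
  have step b : b \in E -> exists2 b', b' \in E &
      ((2 ^ t)%N%:Z %| -3 * (b : nat)%:Z - 5 * (b' : nat)%:Z)%Z.
    move=> Eb; have o3b : ~~ (2 %| -3 * (b : nat)%:Z)%Z by have := E_odd b Eb; lia.
    have [a [b' [aL Eb' dv]]] := dilates_cover t0 E_odd odd4 isT inj4 card4 o3b.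
    move: aL dv; rewrite !inE => /or4P[] /eqP -> dv; last by exists b'.
    - have dv3 : ((2 ^ t)%N%:Z %| 3 * (b : nat)%:Z - -1 * (b' : nat)%:Z)%Z.
        by rewrite -rpredN; move: dv; congr (_ %| _)%Z; ring.
      by have [] := inj4 3 (-1) b b' isT isT Eb Eb' dv3.
    - have dv3 : ((2 ^ t)%N%:Z %| 3 * (b : nat)%:Z - 1 * (b' : nat)%:Z)%Z.
        by rewrite -rpredN; move: dv; congr (_ %| _)%Z; ring.
      by have [] := inj4 3 1 b b' isT isT Eb Eb' dv3.
    - have dv3 : ((2 ^ t)%N%:Z %| 1 * (b : nat)%:Z - -1 * (b' : nat)%:Z)%Z.
        by rewrite -dvd3 -rpredN; move: dv; congr (_ %| _)%Z; ring.
      by have [] := inj4 1 (-1) b b' isT isT Eb Eb' dv3.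
  move: diff; apply: (@dilates_stable_absurd t _ E t0 E_odd [:: 1]) => //.
  - by move=> a /memL1 ->.
  - by move=> a a' b b' /memL1 -> /memL1 ->; apply: inj2.
  - lia.
  move=> _ b /memL1 -> Eb; have [b' Eb' dv] := step b Eb; have [b2 Eb2 dv2] := step b' Eb'.
  exists 1, b2; split=> //.
  have -> : 9 * (1 * (b : nat)%:Z) - 25 * (1 * (b2 : nat)%:Z) =
     -3 * (-3 * (b : nat)%:Z - 5 * (b' : nat)%:Z) + 5 * (-3 * (b' : nat)%:Z - 5 * (b2 : nat)%:Z) by ring.
  by rewrite rpredD // dvdz_mull.
have inj4 : dilates_inj E t [:: 1; -1; 3; -3].
  apply: (inj (r - 3)%N); first by rewrite /t; lia.
  by move=> a; rewrite !inE /intv_star => /or4P[]/eqP ->; lia.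
have odd4 a : a \in [:: 1; -1; 3; -3] -> ~~ (2 %| a)%Z by rewrite !inE => /or4P[]/eqP->.
have diff : ((2 ^ t)%N%:Z %| 9 ^+ (2 ^ (t - 4)) - 1 ^+ (2 ^ (t - 4)) * (1 + (2 ^ t.-1)%N%:Z))%Z.
  have := @expn2_difference 9 1 1 3 (t - 4) isT isT isT erefl.
  by rewrite (_ : 3 + (t - 4) = t.-1)%N ?prednK //; lia.
(* The coefficients [3] and [-3] are excluded as before, but the sign stays undetermined, so the
   stable set is the union of [E] and [-E]. *)
move: diff; apply: (@dilates_stable_absurd t _ E t0 E_odd [:: 1; -1]) => //.
- by move=> a; rewrite !inE => /orP[]/eqP->.
- lia.
move=> a b aL Eb.
have o9b : ~~ (2 %| 9 * (a * (b : nat)%:Z))%Z.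
  by have := E_odd b Eb; move: aL; rewrite !inE => /orP[]/eqP->; lia.
have [a' [b' [aL' Eb' dv]]] := dilates_cover t0 E_odd odd4 isT inj4 card4 o9b.
have [a'1|a'1] := boolP (a' \in [:: 1; -1]); first by exists a', b'; rewrite mul1r.
have [c [cL a'E]] : exists c, c \in [:: 1; -1] /\ a' = 3 * c.
  by move: aL' a'1; rewrite !inE => /or4P[]/eqP-> // _; [exists 1|exists (-1)].
have dv3 : ((2 ^ t)%N%:Z %| (3 * a) * (b : nat)%:Z - c * (b' : nat)%:Z)%Z.
  by rewrite -dvd3; move: dv; rewrite a'E; congr (_ %| _)%Z; ring.
have [] := inj4 (3 * a) c b b' _ _ Eb Eb' dv3.
- by move: aL; rewrite !inE => /orP[]/eqP->.
- by move: cL; rewrite !inE => /orP[]/eqP->.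
by move: aL cL; rewrite !inE => /orP[]/eqP-> /orP[]/eqP->.
Qed.

(* Combination of the odd and even cases *)
Local Close Scope ring_scope.

Theorem theorem3p8 (k1 k2 n p : nat) :
  (0 < k1)%N -> (0 < n)%N -> (k1 <= k2)%N -> (4 <= k1 + k2)%N ->
  prime p -> (p %| (k1 + k2).+1)%N -> p != (k1 + k2).+1 ->
  (exists B : {set 'I_(p ^ n)}, perfect_splitter k1 k2 B) ->
  p ^ n = (k1 + k2).+1.
Proof.
move=> _ n_gt0 k12 k4 p_pr /dvdnP[m km] p_neq [B perfB].
have /(dvdn_pfactor _ _ p_pr)[e en mE] : m %| p ^ n.-1.
  by rewrite -(card_unit_elts p_pr n_gt0 perfB km) dvdn_mulr.
have kr : (k1 + k2).+1 = p ^ e.+1 by rewrite km mE expnSr.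
have e_gt0 : 0 < e.
  by rewrite lt0n; apply: contraNneq p_neq => e0; rewrite kr e0 expn1.
(* Since [e <= n.-1], the alternative to [e.+1 < n] is [n = e.+1], the desired conclusion. *)
have [lt_en|] := ltnP e.+1 n; last first.
  by move=> ne; rewrite kr; congr (p ^ _); lia.
have [p_odd|p_even] := boolP (odd p).
  have e1n : 1 < e.+1 < n by rewrite lt_en andbT.
  by case: (odd_perfect_splitter_absurd p_pr p_odd k12 kr e1n perfB).
have [p2|] := even_prime p_pr; last by rewrite (negPf p_even).
subst p; have e2 : 2 < e.+1.
  by rewrite -(ltn_exp2l 2 e.+1 (isT : 1 < 2)) -kr; lia.
(* Otherwise [#|B| * (k1 + k2) = 2 * (k1 + k2) + 1], so that [k1 + k2 >= 4] would divide 1. *)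
have n_neq : n != e.+2.
  have := perfB.2; move: #|B| => c cE; apply: contra_eqN cE => /eqP nE.
  have -> : 2 ^ n = 2 * (k1 + k2).+1 by rewrite nE expnS kr.
  move: (k1 + k2) k4 => k k4; apply/eqP => ckE.
  have [c2|c3] := leqP c 2; first by have := leq_mul c2 (leqnn k); lia.
  by have := leq_mul c3 (leqnn k); lia.
by case: (two_perfect_splitter_absurd k12 kr e2 _ perfB); lia.
Qed.
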